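(* Assume that $\mathbb{E} Z < \infty$ and that $q_1>0$. Let $N=\max\{n\in\mathbb{N}: B_n=1\}$, where $(B_n)_{n\in\mathbb{N}}$ is the Markov chain defined in the context. Then $\mathbb{E} N<\infty$ if and only if $\mathbb{E} Z^2<\infty$. In particular, if $\mathbb{E} Z^2<\infty$, then the total number of vertices $n\in\mathbb{N}$ outside of the (almost surely) unique infinite tree of the forest has finite expectation.
   Context: $\mathbb{N}=\{1,2,\ldots\}$. Let $Z,Z_1,Z_2,\ldots$ be independent, identically distributed random variables taking values in $\mathbb{N}$, and write $q_n=\mathbb{P}\{Z=n\}$ for $n\in\mathbb{N}$. The coloring $(C_n)_{n\in\mathbb{Z}}$ is defined by $C_i=i$ for all integers $i\le 0$ and $C_n=C_{n-Z_n}$ for $n\in\mathbb{N}$. The subtractive random forest has vertex set $\mathbb{Z}$; each $i\le 0$ is the root of a tree $T^{(i)}$ whose non-root vertices are the $n\in\mathbb{N}$ with $C_n=i$, and each $n\in\mathbb{N}$ is joined by an edge to its parent $n-Z_n$. When $\mathbb{E}Z<\infty$ and $q_1>0$, almost surely there is exactly one $i\le 0$, denoted $I$, such that $T^{(i)}$ is infinite; the number of vertices outside of the unique infinite tree is $|\{n\in\mathbb{N}: C_n\ne I\}|$. The Markov chain $(B_n)_{n\in\mathbb{N}}$ with state space $\mathbb{N}$ is defined by $B_1=1$ and, for $n\ge 1$, $B_{n+1}=B_n+1$ if $Z_{n+1}\le B_n$, and $B_{n+1}=1$ otherwise. Under the assumptions $\mathbb{E}Z<\infty$, $q_1>0$,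 the set $\{n\in\mathbb{N}: B_n=1\}$ is almost surely finite, so $N$ is almost surely well defined. *)

(* Defs.v *)
From mathcomp Require Export all_boot all_order all_algebra.
From mathcomp Require Export finmap.
From mathcomp Require Export all_classical all_reals all_analysis.
From mathcomp Require Import zify.
Export Order.TTheory GRing.Theory Num.Theory.
Export numFieldNormedType.Exports.

Set Implicit Arguments.
Unset Strict Implicit.
Unset Printing Implicit Defensive.

Local Open Scope classical_set_scope.
Local Open Scope ring_scope.

Section independence.
Context {d d'} {T : measurableType d} {T' : measurableType d'} {R : realType}
  {P : probability T R}.

Definition mutually_independent {I : choiceType} (X : I -> {RV P >-> T'}) :=
  forall (J : {fset I}) (A : I -> set T'), (forall i, measurable (A i)) ->
    P (\bigcap_(i in [set` J]) X i @^-1` A i)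
      = (\prod_(i <- J) P (X i @^-1` A i))%E.

Definition identically_distributed {I : Type} (X : I -> {RV P >-> T'}) :=
  forall i j (A : set T'), measurable A ->
    distribution P (X i) A = distribution P (X j) A.

End independence.

(* In this section z : nat -> nat is one realization of the steps Z_1, Z_2, ...;
   the value z 0 is never used. *)
Section forest.
Implicit Types (z : nat -> nat) (n : nat).

(* The recursion C_n = C_{n - z_n} terminates because steps are positive; [k]
   bounds its depth.  See [color_le0] and [color_gt0] for the defining
   equations. *)
Fixpoint color_fuel z (k : nat) (n : int) : int :=
  if n <= 0 then n else
  if k is k'.+1 then color_fuel z k' (n - (z `|n|%N)%:Z) else n.

Definition color z (n : int) : int := color_fuel z `|n|%N n.

Lemma color_le0 z (i : int) : i <= 0 -> color z i = i.
Proof. by rewrite /color; case: `|i|%N => [|k] /= ->. Qed.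

Lemma color_fuelE z (k l : nat) (n : int) : (forall m, (0 < z m)%N) ->
  n <= k%:Z -> n <= l%:Z -> color_fuel z k n = color_fuel z l n.
Proof.
move=> z0; elim: k l n => [|k IH] [|l] n //= nk nl; case: ifPn => // n0.
- by rewrite nk in n0.
- by rewrite nl in n0.
- by have := z0 `|n|%N; move=> zn; apply: IH; lia.
Qed.

Lemma color_gt0 z n : (forall m, (0 < z m)%N) -> (0 < n)%N ->
  color z n%:Z = color z (n%:Z - (z n)%:Z).
Proof.
move=> z0; case: n => // n _; rewrite {1}/color /=.
have zn := z0 n.+1.
have [le0|gt0] := leP (n.+1%:Z - (z n.+1)%:Z) 0.
  rewrite color_le0//; case: n zn le0 => [|n] zn le0 /=; by rewrite ?le0.
by apply: color_fuelE => //; lia.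
Qed.

(* Vertex set of the tree rooted at i <= 0. *)
Definition tree z (i : int) : set int :=
  [set v | v = i \/ 0 < v /\ color z v = i].

Definition infinite_root z (i : int) : Prop :=
  i <= 0 /\ infinite_set (tree z i).

(* Root of the infinite tree; meaningful only if there is exactly one. *)
Definition the_infinite_root z : int := xget 0 [set i | infinite_root z i].

Definition outside z : set nat :=
  [set n | (0 < n)%N /\ color z n%:Z <> the_infinite_root z].

(* The chain is indexed from 1; its value at 0 is a dummy. *)
Fixpoint chain z (n : nat) : nat :=
  match n with
  | 0 => 0%N
  | 1 => 1%N
  | n'.+1 => if (z n <= chain z n')%N then (chain z n').+1 else 1%N
  end.

Definition visits z : set nat := [set n | (0 < n)%N /\ chain z n = 1%N].

(* Maximum of [visits z]; meaningful only if [visits z] is finite. *)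
Definition last_visit z : nat :=
  xget 0%N [set n | visits z n /\ forall m, visits z m -> (m <= n)%N].

End forest.

(* Main.v *)
Require Import Defs.
From mathcomp Require Import measurable_realfun.
From mathcomp Require Import zify ring lra.

(** Write t k = P(Z > k) and u n = P(B_n = 1). As the sum of the t k is E Z, which
is finite, and t 1 < 1, the products of the 1 - t j over 1 <= j <= k are bounded
below by some c > 0 ([prod_oneB_ge], [stay_prob_bounded_below]). So each time the
chain is at 1 it has probability at least c of never coming back, and then it
climbs by one at each step: at time n + k it is at k + 1 and Z_{n+k} <= k.

The visits to 1 form a renewal sequence ([visit_prob_renewal]): u is the
convolution of u with the law of the return time, whose mass at k is the product
of the 1 - t j over j < k times t k. That mass lies between c * t k and t k, and
its total is at most 1 - c. Summing the renewal equation gives that the u n sum up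
to at most 1 / c ([renewal_sum_le]), hence almost surely finitely many visits
([ae_final_visit]). Summing it with weights n shows that the sum of the n * u n is
finite as soon as that of the k * t k is ([renewal_moment_le]), that is, as soon
as E Z^2 is ([expectation_sqr_lty]).

Let N be the last visit. It is at most the sum of all visits, so E N is at most the
sum of the n * u n, and finite if E Z^2 is. Conversely P(N = n) >= c * u n
([prob_final_visit_ge]) and u (k + 1) >= c * t k, so E N is at least c^2 times the
sum of the (k + 1) * t k.

Beyond N no edge of the forest jumps over N, so all vertices beyond N descend from
N ([color_no_return]). The tree of N is therefore the only infinite one
([infinite_tree_no_return]) and fewer than N vertices lie outside of it. *)

Set Implicit Arguments.
Unset Strict Implicit.
Unset Printing Implicit Defensive.

Local Open Scope classical_set_scope.
Local Open Scope ring_scope.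

(** * Renewal inequalities and infinite products *)

Section renewal.
Context {R : realFieldType}.
Implicit Types (a g : nat -> R) (F : nat -> nat -> R).

Lemma sum_antidiagonalE F M :
  \sum_(n < M) \sum_(k < n.+1) F (n - k)%N k
    = \sum_(k < M) \sum_(i < M - k) F i k.
Proof.
elim: M => [|M IH]; first by rewrite !big_ord0.
rewrite big_ord_recr IH [RHS]big_ord_recr /= subSnn big_ord1.
rewrite big_ord_recr /= subnn addrA; congr (_ + _).
rewrite -big_split /=; apply: eq_bigr => k _.
by rewrite subSn ?big_ord_recr// ltnW.
Qed.

Lemma sum_antidiagonal_le F M : (forall i k, 0 <= F i k) ->
  \sum_(n < M) \sum_(k < n.+1) F (n - k)%N k
    <= \sum_(k < M) \sum_(i < M) F i k.
Proof.
move=> F0; rewrite sum_antidiagonalE; apply: ler_sum => k _.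
rewrite -!(big_mkord xpredT (fun i => F i k)).
rewrite [leRHS](@big_cat_nat _ _ _ (M - k)%N) //= ?leq_subr// lerDl.
by apply: sumr_ge0 => i _; apply: F0.
Qed.

(** Summing the renewal inequality bounds a partial sum U of a by
1 + U * (1 - c), because the total mass of g is at most 1 - c. *)
Lemma renewal_sum_le a g c :
  (forall n, 0 <= a n) -> (forall k, 0 <= g k) -> 0 < c ->
  a 0%N <= 1 ->
  (forall n, a n.+1 <= \sum_(k < n.+1) a (n - k)%N * g k) ->
  (forall M, \sum_(k < M) g k <= 1 - c) ->
  forall M, \sum_(n < M) a n <= c^-1.
Proof.
move=> a0 g0 c0 a01 aS gc [|M]; first by rewrite big_ord0 invr_ge0 ltW.
set U := \sum_(_ < _) _.
have UM : \sum_(n < M) a n <= U by rewrite /U big_ord_recr /= lerDl.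
have U0 : 0 <= U by apply: sumr_ge0.
have UE : U <= 1 + U * (1 - c).
  rewrite {1}/U big_ord_recl; apply: lerD => //.
  apply: le_trans (ler_sum _ (fun (i : 'I_M) _ => aS i)) _.
  apply: le_trans (@sum_antidiagonal_le (fun i k => a i * g k) M _) _.
    by move=> i k; rewrite mulr_ge0.
  under eq_bigr do rewrite -mulr_suml.
  by rewrite -mulr_sumr ler_pM// sumr_ge0.
by rewrite -[c^-1]mul1r ler_pdivlMr//; lra.
Qed.

(** Same absorption argument for the weighted sum S: the weight of an index
n = i + k splits as n + 2 = (i + 1) + (k + 1), so S <= 1 + S * (1 - c) + U * D,
where U <= 1 / c is the unweighted sum. *)
Lemma renewal_moment_le a g c D :
  (forall n, 0 <= a n) -> (forall k, 0 <= g k) -> 0 < c ->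
  a 0%N <= 1 ->
  (forall n, a n.+1 <= \sum_(k < n.+1) a (n - k)%N * g k) ->
  (forall M, \sum_(k < M) g k <= 1 - c) ->
  (forall M, \sum_(k < M) k.+1%:R * g k <= D) ->
  forall M, \sum_(n < M) n.+1%:R * a n <= (1 + c^-1 * D) / c.
Proof.
move=> a0 g0 c0 a01 aS gc gD M.
have U M' := @renewal_sum_le _ _ _ a0 g0 c0 a01 aS gc M'.
have D0 : 0 <= D by have := gD 0%N; rewrite big_ord0.
case: M => [|M].
  by rewrite big_ord0 divr_ge0 ?addr_ge0 ?mulr_ge0 ?invr_ge0// ltW.
set S := \sum_(_ < _) _.
have S0 : 0 <= S by apply: sumr_ge0 => i _; rewrite mulr_ge0.
have SM : \sum_(n < M) n.+1%:R * a n <= S.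
  by rewrite /S big_ord_recr /= lerDl mulr_ge0.
have SE : S <= 1 + (S * (1 - c) + c^-1 * D).
  rewrite {1}/S big_ord_recl mul1r; apply: lerD => //.
  have h (i : 'I_M) : true -> (lift ord0 i).+1%:R * a (lift ord0 i) <=
      \sum_(k < i.+1) ((i - k).+1%:R + k.+1%:R) * (a (i - k)%N * g k).
    move=> _; rewrite lift0.
    apply: le_trans (ler_wpM2l _ (aS i)) _ => //.
    rewrite mulr_sumr; apply: ler_sum => k _.
    rewrite -natrD.
    suff -> : ((i - k).+1 + k.+1 = i.+2)%N by [].
    by have := ltn_ord k; lia.
  apply: le_trans (ler_sum _ h) _.
  pose F i k := (i.+1%:R + k.+1%:R) * (a i * g k).
  apply: le_trans (@sum_antidiagonal_le F M _) _.
    by move=> i k; rewrite mulr_ge0 ?addr_ge0 ?mulr_ge0.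
  have -> : \sum_(k < M) \sum_(i < M) F i k =
      (\sum_(i < M) i.+1%:R * a i) * (\sum_(k < M) g k) +
      (\sum_(i < M) a i) * (\sum_(k < M) k.+1%:R * g k).
    rewrite !mulr_sumr -big_split /=; apply: eq_bigr => k _.
    by rewrite !mulr_suml -big_split /=; apply: eq_bigr => i _; rewrite /F; ring.
  apply: lerD; apply: ler_pM => //; apply: sumr_ge0 => i _ //;
    by rewrite mulr_ge0.
by rewrite ler_pdivlMr//; lra.
Qed.

End renewal.

Section products.
Context {R : realType}.

(** An infinite product of factors in [q, 1] with summable defects is positive:
as 1 / (1 - s) = 1 + s / (1 - s) <= 1 + s / q, each factor is at least
exp (- s / q). *)
Lemma prod_oneB_ge (s : nat -> R) q A : 0 < q ->
  (forall k, 0 <= s k) -> (forall k, s k <= 1 - q) ->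
  (forall M, \sum_(k < M) s k <= A) ->
  forall M, expR (- (A / q)) <= \prod_(k < M) (1 - s k).
Proof.
move=> q0 s0 sq sA M.
apply: (@le_trans _ _ (expR (\sum_(k < M) - (s k / q)))).
  rewrite ler_expR sumrN lerN2 -mulr_suml ler_pM2r ?invr_gt0//.
rewrite expR_sum; apply: ler_prod => k _; rewrite expR_ge0/= expRN.
have sk := sq k; have s0k := s0 k.
have p0 : 0 < 1 - s k by lra.
rewrite -[leRHS]invrK lef_pV2 ?posrE ?invr_gt0 ?expR_gt0//.
apply: le_trans (expR_ge1Dx _).
rewrite -[leLHS]mul1r ler_pdivrMr//.
have : s k * (1 - s k) / q >= s k.
  by rewrite ler_pdivlMr// ler_wpM2l//; lra.
have -> : (1 + s k / q) * (1 - s k) = 1 - s k + s k * (1 - s k) / q by ring.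
by lra.
Qed.

(** Telescoping; probabilistically, the chance that independent trials with
failure probabilities s fail at least once, split by the first failure. *)
Lemma sum_prod_oneB (s : nat -> R) M :
  \sum_(k < M) (\prod_(j < k) (1 - s j)) * s k
    = 1 - \prod_(k < M) (1 - s k).
Proof.
elim: M => [|M IH]; first by rewrite !big_ord0 subrr.
by rewrite big_ord_recr IH big_ord_recr /=; ring.
Qed.

End products.

(** * The chain and the forest along one realization *)

Section paths.
Implicit Types (z : nat -> nat) (n k : nat).

Lemma chainS z n : (0 < n)%N ->
  chain z n.+1 = if (z n.+1 <= chain z n)%N then (chain z n).+1 else 1%N.
Proof. by case: n. Qed.

Lemma chain_gt0 z n : (0 < n)%N -> (0 < chain z n)%N.
Proof. by case: n => // -[|n] _ //; rewrite chainS//; case: ifP. Qed.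

Lemma chain_le z n : (chain z n <= n)%N.
Proof.
elim: n => // -[|n] IH //; rewrite chainS//.
by case: ifP => // _; rewrite ltnS.
Qed.

(** If the chain is at 1 at time n, these are the steps that make it climb
forever, to k + 1 at time n + k. *)
Definition no_return z n := forall k, (z (n.+1 + k)%N <= k.+1)%N.

Lemma chain_no_return z n : (0 < n)%N -> chain z n = 1%N -> no_return z n ->
  forall k, chain z (n + k)%N = k.+1.
Proof.
move=> n0 n1 zn; elim=> [|k IH]; first by rewrite addn0.
by rewrite addnS chainS ?addn_gt0 ?n0// IH -addSn zn.
Qed.

Lemma last_visit_no_return z n : visits z n ->
  (forall m, visits z m -> (m <= n)%N) -> no_return z n.
Proof.
move=> [n0 n1] maxn k.
have H j : chain z (n + j)%N = j.+1.
  elim: j => [|j IH]; first by rewrite addn0.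
  have := @chainS z (n + j)%N; rewrite addn_gt0 n0 => /(_ isT).
  rewrite addnS; case: ifP => [_ ->|_ e]; first by rewrite IH.
  suff : ((n + j).+1 <= n)%N by lia.
  by apply: maxn; split.
have := H k.+1; rewrite addnS chainS ?addn_gt0 ?n0// H -addSn.
by case: ifP.
Qed.

Lemma no_return_visits_le z n m : (0 < n)%N -> chain z n = 1%N ->
  no_return z n -> visits z m -> (m <= n)%N.
Proof.
move=> n0 n1 zn [m0 m1]; rewrite leqNgt; apply/negP => nm.
have := chain_no_return n0 n1 zn (m - n)%N.
by rewrite subnKC ?m1; lia.
Qed.

Lemma last_visitE z n : (0 < n)%N -> chain z n = 1%N -> no_return z n ->
  last_visit z = n.
Proof.
move=> n0 n1 zn; rewrite /last_visit; apply: xget_unique.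
  by split=> // m; exact: no_return_visits_le.
move=> m [vm mm]; apply/eqP; rewrite eqn_leq mm// andbT.
exact: (no_return_visits_le n0 n1 zn).
Qed.

Lemma bounded_visits_last z M : (forall m, visits z m -> (m <= M)%N) ->
  exists n, [/\ (0 < n)%N, chain z n = 1%N & no_return z n].
Proof.
move=> bM; pose v := [pred m | (0 < m)%N && (chain z m == 1%N)].
have v1 : exists m, v m by exists 1%N.
have vM m : v m -> (m <= M)%N by move=> /andP[m0 /eqP m1]; apply: bM.
case: (ex_maxnP v1 vM) => n /andP[n0 /eqP n1] maxn; exists n; split => //.
apply: last_visit_no_return => // m [m0 m1].
by apply: maxn; rewrite /= m0 m1.
Qed.

(** The step from n + k is at most k, so the ancestral line of a vertex beyond n
cannot jump over n. *)
Lemma color_no_return z n : (forall m, (0 < z m)%N) -> (0 < n)%N ->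
  no_return z n -> forall k, color z (n + k)%N%:Z = color z n%:Z.
Proof.
move=> z0 n0 zn; elim/ltn_ind => -[|k] IH; first by rewrite addn0.
rewrite color_gt0 ?addn_gt0 ?n0//.
have zk := zn k; have z0k := z0 (n.+1 + k)%N; rewrite addnS -addSn.
have -> : (n.+1 + k)%N%:Z - (z (n.+1 + k)%N)%:Z
   = (n + (k.+1 - z (n.+1 + k)%N))%N%:Z by lia.
by apply: IH; lia.
Qed.

Lemma color_npos z (n : int) : (forall m, (0 < z m)%N) -> color z n <= 0.
Proof.
move=> z0; have [n0|n0] := leP n 0; first by rewrite color_le0.
case: n n0 => // n; elim/ltn_ind: n => n IH n0.
rewrite color_gt0//; have zn := z0 n.
have [h|h] := leP (n%:Z - (z n)%:Z) 0; first by rewrite color_le0.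
have e : n%:Z - (z n)%:Z = (n - z n)%N%:Z by lia.
by rewrite e in h *; apply: IH => //; lia.
Qed.

(** All vertices beyond n are descendants of n and share its color; every other
color occurs only among the finitely many vertices before n. *)
Lemma infinite_tree_no_return z n i : (forall m, (0 < z m)%N) -> (0 < n)%N ->
  no_return z n -> infinite_root z i <-> i = color z n%:Z.
Proof.
move=> z0 n0 zn; split=> [[i0 Ti]|->].
  apply: contrapT => iC; apply: Ti.
  have sub : tree z i `<=` i |` ((Posz : nat -> int) @` `I_n).
    move=> v [->|[v0 vi]]; first by left.
    right; exists `|v|%N; last by rewrite gtz0_abs.
    rewrite /= ltnNge; apply/negP => nv; apply: iC; rewrite -vi.
    rewrite -(color_no_return z0 n0 zn (`|v|%N - n)%N) subnKC//.
    by rewrite gtz0_abs.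
  apply: sub_finite_set sub _; rewrite finite_setU; split => //.
  by apply: finite_image; exact: finite_II.
split; first exact: color_npos.
move=> fin; apply: infinite_nat.
have -> : [set: nat] = (fun k => (n + k)%N%:Z) @^-1` tree z (color z n%:Z).
  apply/seteqP; split=> // k _; right; split; first by lia.
  exact: color_no_return.
by apply: finite_preimage => // j k _ _ [] /addnI.
Qed.

Lemma exists_unique_infinite_root z n : (forall m, (0 < z m)%N) -> (0 < n)%N ->
  no_return z n -> exists! i, infinite_root z i.
Proof.
move=> z0 n0 zn; exists (color z n%:Z); split.
  exact/(infinite_tree_no_return _ z0 n0 zn).
by move=> i /(infinite_tree_no_return _ z0 n0 zn).
Qed.

Lemma outside_lt z n : (forall m, (0 < z m)%N) -> (0 < n)%N ->
  no_return z n -> outside z `<=` `I_n.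
Proof.
move=> z0 n0 zn m [m0]; apply: contra_notP => /negP; rewrite -leqNgt => nm.
rewrite /the_infinite_root (@xget_unique _ _ _ (color z n%:Z)).
- by rewrite -(color_no_return z0 n0 zn (m - n)%N) subnKC.
- exact/(infinite_tree_no_return _ z0 n0 zn).
- by move=> i /(infinite_tree_no_return _ z0 n0 zn).
Qed.

End paths.

Local Open Scope ereal_scope.

(** * Integrals and series of nonnegative terms *)

(** The integral of a nonnegative function is a supremum over the simple functions
below it, hence monotone even for functions that are not known to be measurable.
So the last visit and the number of vertices outside of the infinite tree can be
estimated without showing that they are measurable. *)
Lemma ge0_le_integralT d (T : measurableType d) (R : realType)
    (mu : {measure set T -> \bar R}) (f g : T -> \bar R) :
  (forall x, 0 <= f x) -> (forall x, f x <= g x) ->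
  \int[mu]_x f x <= \int[mu]_x g x.
Proof.
move=> f0 fg; have g0 x : 0 <= g x by exact: le_trans (f0 x) (fg x).
rewrite !ge0_integralTE//; apply: ge_ereal_sup => _ [h hf <-].
by apply: ereal_sup_ubound; exists h => // x; exact: le_trans (hf x) (fg x).
Qed.

Lemma nneseries_lty (R : realType) (a : nat -> R) :
  (forall n, (0 <= a n)%R) ->
  \sum_(0 <= n <oo) (a n)%:E < +oo <->
  exists D : R, forall M, (\sum_(n < M) a n <= D)%R.
Proof.
move=> a0; have a0' n : 0 <= (a n)%:E by rewrite lee_fin.
split=> [fin|[D aD]].
  exists (fine (\sum_(0 <= n <oo) (a n)%:E)) => M.
  rewrite -lee_fin fineK.
    rewrite -(big_mkord xpredT) -sumEFin; apply: nneseries_lim_ge => //.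
  by rewrite ge0_fin_numE// nneseries_ge0.
apply: (@le_lt_trans _ _ D%:E); last exact: ltry.
apply: lime_le; first by apply: is_cvg_nneseries.
by near=> M; rewrite sumEFin big_mkord lee_fin.
Unshelve. all: by end_near. Qed.

(** * Law of the chain *)

Section chain_law.
Context (R : realType) (d : measure_display) (T : measurableType d)
    (P : probability T R) (Z : nat -> {RV P >-> nat}).

Definition at_state n b : set T := [set w | chain (Z ^~ w) n = b].
Definition steps_in m k (A : nat -> set nat) : set T :=
  \bigcap_(i in [set i | (m <= i < k)%N]) Z i @^-1` A i.
Definition moves c b : set nat :=
  [set x | (if (x <= c)%N then c.+1 else 1%N) = b].

(** The steps that make the chain climb from state 1 at time n.+1 to state k.+1
at time n.+1 + k: at time i - 1 it is at state i - n.+1. *)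
Definition stays n k : set T :=
  steps_in n.+2 (n.+2 + k) (fun i => [set x | (x <= i - n.+1)%N]).

Lemma measurable_step i (A : set nat) : measurable (Z i @^-1` A).
Proof. exact: measurable_funPTI. Qed.

Lemma measurable_steps_in m k A : measurable (steps_in m k A).
Proof. by apply: bigcap_measurableType => i _; exact: measurable_step. Qed.

Lemma at_stateS n b : at_state n.+2 b =
  \bigcup_(c < n.+2) (at_state n.+1 c `&` Z n.+2 @^-1` moves c b).
Proof.
rewrite /at_state /moves; apply/seteqP; split=> [w /= h|w [c _ [<- <-]]//].
exists (chain (Z ^~ w) n.+1) => //=.
by rewrite ltnS; exact: chain_le.
Qed.

Lemma measurable_cst_state (a b : nat) : measurable [set _ : T | a = b].
Proof.
have [->|ab] := eqVneq a b.
  by rewrite (_ : [set _ | _] = setT)//; apply/seteqP; split.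
rewrite (_ : [set _ | _] = set0)//; apply/seteqP; split => // w /= /eqP.
by rewrite (negbTE ab).
Qed.

Lemma measurable_at_state n b : measurable (at_state n b).
Proof.
elim: n b => [|[|n] IH] b.
- exact: (measurable_cst_state 0%N).
- exact: (measurable_cst_state 1%N).
- rewrite at_stateS; apply: bigcup_measurable => c _.
  by apply: measurableI; [exact: IH|exact: measurable_step].
Qed.

Lemma prob_at_stateS n b (C : set T) : measurable C ->
  P (at_state n.+2 b `&` C) =
  \sum_(c < n.+2) P (at_state n.+1 c `&` (Z n.+2 @^-1` moves c b `&` C)).
Proof.
move=> mC; rewrite at_stateS bigcup_mkord big_distrl/=.
under eq_bigr do rewrite -setIA.
rewrite measure_bigsetU_ord//.
- move=> i; apply: measurableI; first exact: measurable_at_state.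
  by apply: measurableI => //; exact: measurable_step.
- move=> i j _ _ [w [[/= wi _] [wj _]]]; apply: val_inj.
  by rewrite /= -wi -wj.
Qed.

Context (Z_indep : mutually_independent Z).

Lemma prob_steps_in m k A :
  P (steps_in m k A) = \prod_(m <= i < k) P (Z i @^-1` A i).
Proof.
have := Z_indep (seq_fset tt (index_iota m k)) (fun i => _ : measurable (A i)).
move=> /(_ (fun=> I)).
rewrite (perm_big _ (seq_fset_perm _ _))/= undup_id ?iota_uniq// => <-.
congr (P _); rewrite /steps_in; congr (\bigcap_(i in _) _); apply/seteqP.
have E i : (i \in seq_fset tt (index_iota m k)) = (m <= i < k)%N.
  by rewrite seq_fsetE mem_index_iota.
by split=> i; rewrite /mkset -E.
Qed.

(** The state at time m.+1 is a function of the steps up to time m.+1, hence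
independent of later ones. The number of later steps has to be arbitrary for the
induction: conditioning on the state one unit of time earlier adds the step taken
in between to them. *)
Lemma prob_at_state_steps_in m b k A :
  P (at_state m.+1 b `&` steps_in m.+2 k A) =
  P (at_state m.+1 b) * \prod_(m.+2 <= i < k) P (Z i @^-1` A i).
Proof.
elim: m b k A => [|m IH] b k A.
  rewrite -prob_steps_in.
  have [->|b1] := eqVneq b 1%N.
    rewrite (_ : at_state 1 1 = setT) ?setTI ?probability_setT ?mul1e//.
    by apply/seteqP; split.
  rewrite (_ : at_state 1 b = set0) ?set0I ?measure0 ?mul0e//.
  by apply/seteqP; split=> // w /= /esym/eqP; rewrite (negbTE b1).
have step k' A' : P (at_state m.+2 b `&` steps_in m.+3 k' A') =
    (\sum_(c < m.+2) P (at_state m.+1 c) * P (Z m.+2 @^-1` moves c b)) *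
    \prod_(m.+3 <= i < k') P (Z i @^-1` A' i).
  rewrite prob_at_stateS; last exact: measurable_steps_in.
  rewrite ge0_sume_distrl; last by move=> i _; rewrite mule_ge0.
  apply: eq_bigr => c _.
  pose A'' i := if i == m.+2 then moves c b else A' i.
  have -> : Z m.+2 @^-1` moves c b `&` steps_in m.+3 k' A' =
      steps_in m.+2 (maxn k' m.+3) A''.
    rewrite /steps_in /A''; apply/seteqP; split=> w /=.
      move=> [wm wk] i /= /andP[mi ik]; case: eqVneq => [->//|im].
      by apply: wk => /=; lia.
    move=> wk; split; first by have := wk m.+2; rewrite eqxx; apply => /=; lia.
    move=> i /= mik; have := wk i; have -> : (i == m.+2) = false by lia.
    by apply => /=; lia.
  (* the maximum keeps step m.+2 in the range when k' does not reach it *)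
  rewrite IH -muleA; congr (_ * _).
  rewrite big_ltn; last by lia.
  rewrite /A'' eqxx; congr (_ * _).
  have [km|mk] := leqP m.+3 k'.
    apply: eq_big_nat => i im.
    by have -> : (i == m.+2) = false by lia.
  by rewrite !big_geq// ltnW.
rewrite step; congr (_ * _).
have := step m.+3 A; rewrite big_geq// mule1 => <-.
congr (P _); rewrite /steps_in (_ : [set i | _] = set0) ?bigcap_set0 ?setIT//.
by apply/seteqP; split=> // i /=; lia.
Qed.

Context (Z_ident : identically_distributed Z).

Definition tail k : R := fine (P (Z 0 @^-1` [set x | (k < x)%N])).
(** The probability of climbing from state 1 to state k.+1 without a return. *)
Definition stay_prob k : R := (\prod_(j < k) (1 - tail j.+1))%R.
Definition visit_prob n : R := fine (P (at_state n 1)).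

Lemma probE (A : set T) : measurable A -> P A = (fine (P A))%:E.
Proof. by move=> mA; rewrite fineK// fin_num_measure. Qed.

Lemma visit_probE n : P (at_state n 1) = (visit_prob n)%:E.
Proof. by apply: probE; exact: measurable_at_state. Qed.

Lemma tailE i k : P (Z i @^-1` [set x | (k < x)%N]) = (tail k)%:E.
Proof.
rewrite /tail -probE; last exact: measurable_step.
exact: (Z_ident i 0%N (A := [set x | (k < x)%N])).
Qed.

Lemma prob_step_le i k : P (Z i @^-1` [set x | (x <= k)%N]) = (1 - tail k)%:E.
Proof.
have -> : Z i @^-1` [set x | (x <= k)%N] = ~` (Z i @^-1` [set x | (k < x)%N]).
  by apply/seteqP; split=> w /=; rewrite ltnNge;
    [move=> ->|move=> /negP; rewrite negbK].
by rewrite probability_setC ?tailE//; exact: measurable_step.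
Qed.

Lemma prob_visit_stay n k : P (at_state n.+1 1 `&` stays n k) =
  (visit_prob n.+1 * stay_prob k)%:E.
Proof.
rewrite /stays prob_at_state_steps_in visit_probE EFinM; congr (_ * _).
rewrite -{1}[n.+2]add0n big_addn addKn big_mkord /stay_prob -prodEFin.
apply: eq_bigr => j _; rewrite -(prob_step_le (j + n.+2)).
by rewrite addnS -addSn addnK.
Qed.

(** The chain reaches a state k.+1 only by climbing from 1 step by step. *)
Lemma at_state_stay n k :
  at_state (n.+1 + k) k.+1 = at_state n.+1 1 `&` stays n k.
Proof.
elim: k => [|k IH].
  rewrite addn0 /stays /steps_in (_ : [set i | _] = set0) ?bigcap_set0 ?setIT//.
  by apply/seteqP; split=> // i /=; lia.
have -> : at_state (n.+1 + k.+1) k.+2 =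
    at_state (n.+1 + k) k.+1 `&` Z (n.+2 + k) @^-1` [set x | (x <= k.+1)%N].
  rewrite /at_state addnS; apply/seteqP; split=> w /=; rewrite -?addSn.
    by case: ifP => // h [e]; rewrite -e.
  by move=> [-> ->].
rewrite IH -setIA; congr (_ `&` _); apply/seteqP; split=> w.
  move=> [ws wk] i /= im; have [->|ik] := eqVneq i (n.+2 + k)%N.
    by have -> : (n.+2 + k - n.+1 = k.+1)%N by lia.
  by apply: ws => /=; lia.
move=> ws; split; first by move=> i /= im; apply: ws => /=; lia.
have := ws (n.+2 + k)%N; rewrite /= (_ : (n.+2 + k - n.+1 = k.+1)%N); last by lia.
by apply; lia.
Qed.

(** The renewal equation, by the state k.+1 from which the chain falls back to 1
at time n.+2: it has been climbing since its visit to 1 at time (n - k).+1. *)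
Lemma visit_prob_renewal n : visit_prob n.+2 =
  (\sum_(k < n.+1) visit_prob (n - k).+1 * (stay_prob k * tail k.+1))%R.
Proof.
apply: EFin_inj; rewrite -visit_probE -[at_state _ _]setIT prob_at_stateS//.
rewrite big_ord_recl /= (_ : at_state n.+1 0 = set0); last first.
  apply/seteqP; split=> // w /= e.
  by have := chain_gt0 (Z ^~ w) (ltn0Sn n); rewrite e.
rewrite set0I measure0 add0e -sumEFin; apply: eq_bigr => -[k kn] _ /=.
rewrite /bump leq0n add1n setIT.
have -> : moves k.+1 1 = [set x | (k.+1 < x)%N].
  by apply/seteqP; split=> x; rewrite /moves /= ltnNge; case: leqP.
have := @prob_at_state_steps_in n k.+1 n.+3 (fun=> [set x | (k.+1 < x)%N]).
rewrite big_nat1 tailE.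
rewrite (_ : steps_in _ _ _ = Z n.+2 @^-1` [set x | (k.+1 < x)%N]).
  move=> ->; have e : ((n - k).+1 + k)%N = n.+1 by lia.
  by rewrite -[in at_state _ _]e at_state_stay prob_visit_stay mulrA EFinM.
apply/seteqP; split=> w; first by apply=> /=; rewrite !leqnn.
by move=> h i /= im; have -> : i = n.+2 by lia.
Qed.

Definition final_visit n : set T :=
  at_state n.+1 1 `&` [set w | no_return (Z ^~ w) n.+1].

Lemma final_visitE n :
  final_visit n = \bigcap_k (at_state n.+1 1 `&` stays n k).
Proof.
apply/seteqP; split=> [w [wn wr] k _|w h].
  split=> // i /= im; have := wr (i - n.+2)%N.
  by rewrite subnKC; [have -> : (i - n.+1 = (i - n.+2).+1)%N by lia|lia].
split; first by have [] := h 0%N I.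
move=> k; have [_ /(_ (n.+2 + k)%N)] := h k.+1 I.
rewrite /= (_ : (n.+2 + k - n.+1 = k.+1)%N); last by lia.
by apply; lia.
Qed.

Lemma measurable_final_visit n : measurable (final_visit n).
Proof.
rewrite final_visitE; apply: bigcapT_measurable => k.
by apply: measurableI; [exact: measurable_at_state|exact: measurable_steps_in].
Qed.

(** The event is a decreasing limit, over k, of the events that there is no return
during k units of time; continuity from above gives the bound. *)
Lemma prob_final_visit_ge n c : (forall k, (c <= stay_prob k)%R) ->
  (visit_prob n.+1 * c)%:E <= P (final_visit n).
Proof.
move=> cs; have mf := measurable_final_visit n.
rewrite final_visitE in mf *; set F := fun k => _ `&` _ in mf *.
have mF k : measurable (F k).
  by apply: measurableI; [exact: measurable_at_state|exact: measurable_steps_in].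
have niF : {homo F : n m / (n <= m)%N >-> (m <= n)%O}.
  move=> i j ij; apply/subsetPset => w [w1 ws]; split=> // l /= lm.
  by apply: ws => /=; lia.
have := @nonincreasing_cvg_mu _ _ _ P F _ mF mf niF.
move=> /(_ (le_lt_trans (probability_le1 _ (mF _)) (ltry _))) cv.
rewrite -(cvg_lim _ cv)//; apply: lime_ge.
  by apply/cvg_ex; eexists; exact: cv.
apply: nearW => k /=; rewrite prob_visit_stay lee_fin ler_wpM2l//.
exact: fine_ge0.
Qed.

End chain_law.

(** * Expectations *)

Section expectations.
Context (R : realType) (d : measure_display) (T : measurableType d)
    (P : probability T R) (Z : nat -> {RV P >-> nat}).

Lemma measurable_scaled_indic (r : R) (A : set T) : measurable A ->
  measurable_fun setT (fun w => (r * \1_A w)%:E).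
Proof.
move=> mA; apply/measurable_EFinP.
by apply: measurable_funM => //; exact: measurable_indic.
Qed.

Lemma integral_scaled_indic (r : R) (A : set T) : (0 <= r)%R -> measurable A ->
  \int[P]_w (r * \1_A w)%:E = (r * fine (P A))%:E.
Proof.
move=> r0 mA; under eq_integral do rewrite EFinM.
rewrite ge0_integralZl//.
- by rewrite integral_indic// setIT EFinM -probE.
- by apply/measurable_EFinP; exact: measurable_indic.
Qed.

Lemma integral_sum_indic (a : nat -> R) (A : nat -> set T) :
  (forall n, (0 <= a n)%R) -> (forall n, measurable (A n)) ->
  \int[P]_w (\sum_(0 <= n <oo) (a n * \1_(A n) w)%:E) =
  \sum_(0 <= n <oo) (a n * fine (P (A n)))%:E.
Proof.
move=> a0 mA; rewrite integral_nneseries//.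
- by apply: eq_eseriesr => n _; rewrite integral_scaled_indic.
- by move=> n; exact: measurable_scaled_indic.
- by move=> n w _; rewrite lee_fin mulr_ge0.
Qed.

(** Layer cake formula for a function written as a sum of increments. *)
Lemma expectation_partial_sum (a : nat -> R) (f : nat -> R) :
  (forall n, (0 <= a n)%R) -> (forall x, f x = \sum_(k < x) a k)%R ->
  'E_P[(fun w => f (Z 0%N w))] = \sum_(0 <= k <oo) (a k * tail Z k)%:E.
Proof.
move=> a0 fE; rewrite expectation.unlock -integral_sum_indic//.
  apply: eq_integral => w _; rewrite fE.
  rewrite (nneseries_split 0 (Z 0%N w)) => [|k _]; last first.
    by rewrite lee_fin mulr_ge0.
  rewrite eseries0 ?adde0 ?add0n => [|k /= Zk _]; last first.
    by rewrite indicE memNset ?mulr0//= ltnNge Zk.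
  rewrite sumEFin big_mkord; congr EFin; apply: eq_bigr => k _.
  by rewrite indicE mem_set ?mulr1//=; exact: ltn_ord.
by move=> n; exact: measurable_step.
Qed.

Lemma expectation_tail :
  'E_P[(fun w => (Z 0%N w)%:R : R)] = \sum_(0 <= k <oo) (tail Z k)%:E.
Proof.
rewrite (@expectation_partial_sum (fun=> 1%R) (fun x => x%:R))//.
  by under eq_eseriesr do rewrite mul1r.
by move=> x; rewrite sumr_const card_ord.
Qed.

Lemma expectation_sqr_tail :
  'E_P[(fun w => (Z 0%N w)%:R ^+ 2 : R)%R] =
  \sum_(0 <= k <oo) (k.*2.+1%:R * tail Z k)%:E.
Proof.
pose f x : R := (x%:R ^+ 2)%R.
apply: (@expectation_partial_sum (fun k => k.*2.+1%:R) f) => //.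
rewrite /f; elim=> [|x IH]; first by rewrite big_ord0 expr0n.
by rewrite big_ord_recr /= -IH -!natr1 -mul2n natrM; ring.
Qed.

(** The sum of all visit times. It is measurable and bounds the last visit at every
outcome, also where there are infinitely many visits, so it stands for the last
visit in upper estimates. *)
Definition visit_sum (w : T) : \bar R :=
  \sum_(0 <= n <oo) (n.+1%:R * \1_(at_state Z n.+1 1) w)%:E.

Lemma visit_sum_ge w n : visits (Z ^~ w) n -> n%:R%:E <= visit_sum w.
Proof.
move=> [n0 n1]; case: n n0 n1 => // n _ n1.
rewrite /visit_sum (nneseriesD1 (n := n))//.
rewrite indicE mem_set// mulr1 leeDl// nneseries_ge0//.
Qed.

Lemma visit_sum_ge0 w : 0 <= visit_sum w.
Proof. by apply: nneseries_ge0 => k _ _; rewrite lee_fin mulr_ge0. Qed.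

Lemma last_visit_le_visit_sum w : (last_visit (Z ^~ w))%:R%:E <= visit_sum w.
Proof.
rewrite /last_visit; case: xgetP => [n _ [vn _]|_]; last exact: visit_sum_ge0.
exact: visit_sum_ge.
Qed.

Context (Z_pos : forall (n : nat) (w : T), (0 < Z n w)%N).

(** Where the sum is finite it bounds all visits, so there is a final visit n, and
all vertices outside of the infinite tree precede n. *)
Lemma counting_outside_le_visit_sum w :
  (counting (outside (Z ^~ w)) : \bar R) <= visit_sum w.
Proof.
have [->|Sfin] := eqVneq (visit_sum w) +oo; first exact: leey.
have Sw : visit_sum w = (fine (visit_sum w))%:E.
  by rewrite fineK// ge0_fin_numE ?visit_sum_ge0// ltey.
have [|n [n0 n1 zn]] :=
  @bounded_visits_last (Z ^~ w) (Num.truncn (fine (visit_sum w))).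
  move=> m /visit_sum_ge; rewrite Sw lee_fin => mS.
  by rewrite truncn_ge_nat// (le_trans _ mS).
have zp m : (0 < Z m w)%N by [].
have sub := outside_lt zp n0 zn.
apply: le_trans (visit_sum_ge (conj n0 n1)).
have fin : finite_set (outside (Z ^~ w)).
  by apply: sub_finite_set sub _; exact: finite_II.
rewrite /counting asboolT// lee_fin ler_nat.
have fs : (fset_set (outside (Z ^~ w)) `<=` fset_set `I_n)%fset.
  by rewrite -fset_set_sub//; exact: finite_II.
by apply: leq_trans (fsubset_leq_card fs) _; rewrite (card_fset_set (card_eqxx _)).
Qed.

(** The events of final visits at different times are disjoint, so at most one
term of the sum differs from 0, and that one is the last visit. *)
Lemma final_visit_sum_le w M :
  (\sum_(n < M) n.+1%:R * \1_(final_visit Z n) w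
    <= (last_visit (Z ^~ w))%:R :> R)%R.
Proof.
set N := last_visit _.
apply: (@le_trans _ _ (\sum_(n < M) if n.+1 == N then N%:R else 0)%R).
  apply: ler_sum => n _; rewrite indicE.
  have [|] := boolP (w \in final_visit Z n); last by rewrite mulr0; case: ifP.
  by rewrite inE => -[n1 /last_visitE]; rewrite /N => ->//; rewrite eqxx mulr1.
case: N => [|N]; first by rewrite big1.
rewrite -big_mkcond/=.
have [NM|MN] := ltnP N M; last first.
  by rewrite big_pred0// => n; rewrite eqSS; have := ltn_ord n; lia.
by rewrite (big_pred1 (Ordinal NM))// => n; rewrite eqSS.
Qed.

Lemma final_visit_expectation_ge M :
  (\sum_(n < M) n.+1%:R * fine (P (final_visit Z n)))%R%:E <=
  'E_P[(fun w => (last_visit (Z ^~ w))%:R : R)].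
Proof.
rewrite expectation.unlock -sumEFin.
under eq_bigr => n _ do
  rewrite -(integral_scaled_indic _ (measurable_final_visit _ _))//.
rewrite -ge0_integral_sum//.
- apply: ge0_le_integralT => w.
    by rewrite sume_ge0// => n _; rewrite lee_fin mulr_ge0.
  by rewrite sumEFin lee_fin final_visit_sum_le.
- by move=> n; apply: measurable_scaled_indic; exact: measurable_final_visit.
Qed.

Lemma last_visit_expectation_le : 'E_P[(fun w => (last_visit (Z ^~ w))%:R : R)]
  <= \sum_(0 <= n <oo) (n.+1%:R * visit_prob Z n.+1)%:E.
Proof.
rewrite expectation.unlock -integral_sum_indic//; last first.
  by move=> n; exact: measurable_at_state.
by apply: ge0_le_integralT => w; [rewrite lee_fin|exact: last_visit_le_visit_sum].
Qed.

Lemma outside_expectation_le : \int[P]_w (counting (outside (Z ^~ w)) : \bar R)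
  <= \sum_(0 <= n <oo) (n.+1%:R * visit_prob Z n.+1)%:E.
Proof.
rewrite -integral_sum_indic//; last by move=> n; exact: measurable_at_state.
apply: ge0_le_integralT => w; last exact: counting_outside_le_visit_sum.
by rewrite /counting; case: ifP => // _; rewrite lee_fin.
Qed.

(** Borel-Cantelli: almost surely there are only finitely many visits. *)
Lemma ae_final_visit : \sum_(0 <= n <oo) (visit_prob Z n.+1)%:E < +oo ->
  {ae P, forall w, exists n, [/\ (0 < n)%N, chain (Z ^~ w) n = 1%N
     & no_return (Z ^~ w) n]}.
Proof.
move=> fin; pose F n := at_state Z n.+1 1.
have mF n : measurable (F n) by exact: measurable_at_state.
have F0 : P (lim_sup_set F) = 0.
  apply: lim_sup_set_cvg0 => //.
  rewrite (_ : \sum_(n <oo) _ = \sum_(0 <= n <oo) (visit_prob Z n.+1)%:E)//.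
  by apply: eq_eseriesr => n _; exact: visit_probE.
exists (lim_sup_set F); split=> //.
  apply: bigcapT_measurable => n; apply: bigcup_measurable => k _; exact: mF.
move=> w; apply: contra_notP => nF.
have [M hM] : exists M, forall j, (M <= j)%N -> ~ F j w.
  apply: contrapT => h; apply: nF => M _; apply: contrapT => h'.
  by apply: h; exists M => j Mj Fj; apply: h'; exists j.
apply: (@bounded_visits_last _ M) => -[|m] [m0 m1] //.
by rewrite ltnNge; apply/negP => Mm; exact: (hM m Mm m1).
Qed.

Context (Z_ident : identically_distributed Z).

Lemma tail_ge0 k : (0 <= tail Z k)%R. Proof. exact: fine_ge0. Qed.

Lemma tail_le1 k : (tail Z k <= 1)%R.
Proof.
rewrite -lee_fin -(tailE Z_ident 0).
by apply: probability_le1; exact: measurable_step.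
Qed.

Lemma stay_prob_le1 k : (stay_prob Z k <= 1)%R.
Proof.
apply: prodr_ile1 => j _; have := tail_ge0 j.+1; have := tail_le1 j.+1; lra.
Qed.

Lemma visit_prob_ge0 n : (0 <= visit_prob Z n)%R. Proof. exact: fine_ge0. Qed.

Lemma visit_prob1 : visit_prob Z 1 = 1%R.
Proof.
apply: EFin_inj; rewrite -visit_probE -[RHS](probability_setT P).
by congr (P _); apply/seteqP; split.
Qed.

Lemma stay_prob_bounded_below :
  'E_P[(fun w => (Z 0%N w)%:R : R)] < +oo -> 0 < P (Z 0%N @^-1` [set 1%N]) ->
  exists2 c : R, (0 < c)%R & forall k, (c <= stay_prob Z k)%R.
Proof.
rewrite expectation_tail => /(nneseries_lty tail_ge0)[A hA] q1.
have q0 : (0 < 1 - tail Z 1)%R.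
  rewrite -lte_fin -(prob_step_le Z_ident 0); apply: lt_le_trans q1 _.
  apply: le_measure; rewrite ?inE; try exact: measurable_step.
  by move=> w /= ->.
exists (expR (- (A / (1 - tail Z 1)))); first exact: expR_gt0.
move=> k; apply: (@prod_oneB_ge _ (fun k => tail Z k.+1)) => // [j|j|M].
- exact: tail_ge0.
- rewrite opprB addrC subrK -lee_fin -!(tailE Z_ident 0).
  apply: le_measure; rewrite ?inE; try exact: measurable_step.
  by move=> w /=; apply: leq_ltn_trans.
- apply: le_trans (hA M.+1); rewrite [leRHS]big_ord_recl lerDr; exact: tail_ge0.
Qed.

(** The expectation of the square is the sum of (2 k + 1) P(Z > k); the index shift
matches the gaps between visits, as a return after k + 1 units of time needs a
step larger than k + 1. *)
Lemma expectation_sqr_lty : 'E_P[(fun w => (Z 0%N w)%:R ^+ 2 : R)%R] < +oo <->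
  exists D : R, forall M, (\sum_(k < M) k.+1%:R * tail Z k.+1 <= D)%R.
Proof.
have t0 := tail_ge0.
rewrite expectation_sqr_tail nneseries_lty; last by move=> k; rewrite mulr_ge0.
split=> -[D hD].
  exists D => M; apply: le_trans (hD M.+1); rewrite [leRHS]big_ord_recl.
  rewrite -[leLHS]add0r; apply: lerD; first by rewrite mulr_ge0.
  by apply: ler_sum => k _; rewrite lift0 ler_wpM2r// ler_nat; lia.
exists (1 + 3 * D)%R => -[|M].
  by rewrite big_ord0; have := hD 0%N; rewrite big_ord0; lra.
rewrite big_ord_recl mul1r; apply: lerD; first exact: tail_le1.
apply: le_trans (_ : 3 * \sum_(k < M) k.+1%:R * tail Z k.+1 <= _)%R; last first.
  by rewrite ler_wpM2l.
rewrite mulr_sumr; apply: ler_sum => k _; rewrite lift0 mulrA ler_wpM2r//.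
by rewrite -natrM ler_nat; lia.
Qed.

End expectations.

(* MathComp-Analysis.  [Z 0] is the generic variable Z, and [Z n] is Z_n for
   n >= 1; [Z ^~ w] is the realization of the sequence at the outcome w. *)
Theorem theorem2 (R : realType) (d : measure_display) (T : measurableType d)
    (P : probability T R) (Z : nat -> {RV P >-> nat})
    (Z_pos : forall (n : nat) (w : T), (0 < Z n w)%N)
    (Z_indep : mutually_independent Z)
    (Z_ident : identically_distributed Z)
    (EZ : 'E_P[(fun w => (Z 0%N w)%:R : R)] < +oo)
    (q1 : 0 < P (Z 0%N @^-1` [set 1%N])) :
  [/\ {ae P, forall w, finite_set (visits (Z ^~ w))},
      {ae P, forall w, exists! i : int, infinite_root (Z ^~ w) i},
      ('E_P[(fun w => (last_visit (Z ^~ w))%:R : R)] < +oo <->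
       'E_P[(fun w => (Z 0%N w)%:R ^+ 2 : R)%R] < +oo) &
      ('E_P[(fun w => (Z 0%N w)%:R ^+ 2 : R)%R] < +oo ->
       \int[P]_w (counting (outside (Z ^~ w)) : \bar R) < +oo)].
Proof.
have [c c0 cs] := stay_prob_bounded_below Z_ident EZ q1.
have t0 := tail_ge0 Z; have u0 := visit_prob_ge0 Z.
pose a n := visit_prob Z n.+1.
pose g k := (stay_prob Z k * tail Z k.+1)%R.
have s0 k : (0 <= stay_prob Z k)%R by rewrite (le_trans (ltW c0)).
have g0 k : (0 <= g k)%R by rewrite mulr_ge0.
have a0 n : (0 <= a n)%R by exact: u0.
have a1 : (a 0%N <= 1)%R by rewrite /a visit_prob1.
have aS n : (a n.+1 <= \sum_(k < n.+1) a (n - k)%N * g k)%R.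
  by rewrite /a visit_prob_renewal.
have gc M : (\sum_(k < M) g k <= 1 - c)%R.
  by rewrite (sum_prod_oneB (fun k => tail Z k.+1)) lerD2l lerN2; exact: cs.
have a_sum : \sum_(0 <= n <oo) (visit_prob Z n.+1)%:E < +oo.
  apply/nneseries_lty; first by move=> n; exact: u0.
  by exists (c^-1)%R; apply: (@renewal_sum_le _ a g).
have a_moment : 'E_P[(fun w => (Z 0%N w)%:R ^+ 2 : R)%R] < +oo ->
    \sum_(0 <= n <oo) (n.+1%:R * visit_prob Z n.+1)%:E < +oo.
  move=> /(expectation_sqr_lty Z_ident)[D hD].
  apply/nneseries_lty; first by move=> n; rewrite mulr_ge0.
  exists ((1 + c^-1 * D) / c)%R; apply: (@renewal_moment_le _ a g) => // M.
  apply: le_trans (hD M); apply: ler_sum => k _; rewrite ler_wpM2l//.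
  by rewrite ler_piMl// stay_prob_le1.
have aef := ae_final_visit a_sum.
split.
- apply: filterS aef => w [n [n0 n1 zn]].
  apply: (@sub_finite_set _ _ `I_n.+1); last exact: finite_II.
  by move=> m; rewrite /= ltnS; exact: no_return_visits_le.
- apply: filterS aef => w [n [n0 n1 zn]].
  exact: (exists_unique_infinite_root (Z_pos ^~ w) n0 zn).
- split=> [EN|EZ2]; last first.
    exact: le_lt_trans (last_visit_expectation_le Z) (a_moment EZ2).
  apply/(expectation_sqr_lty Z_ident).
  pose EN' := fine 'E_P[(fun w => (last_visit (Z ^~ w))%:R : R)].
  (* one factor c for reaching state k.+1, one for never returning again *)
  exists (EN' / (c * c))%R => M.
  rewrite ler_pdivlMr ?mulr_gt0// -lee_fin /EN' fineK; last first.
    by rewrite ge0_fin_numE// expectation.unlock integral_ge0.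
  apply: le_trans (final_visit_expectation_ge Z M.+1).
  rewrite lee_fin [leRHS]big_ord_recl mulr_suml -[leLHS]add0r.
  apply: lerD; first by rewrite mulr_ge0// fine_ge0.
  apply: ler_sum => k _; rewrite lift0 -mulrA.
  have c1 := ltW c0.
  apply: ler_pM; [by []|by rewrite !mulr_ge0|by rewrite ler_nat|].
  rewrite mulrA; apply: (@le_trans _ _ (visit_prob Z k.+2 * c)%R).
    (* in the renewal equation, only the return after the visit at time 1 *)
    rewrite ler_wpM2r// visit_prob_renewal// big_ord_recr /=.
    rewrite subnn visit_prob1 mul1r.
    apply: le_trans (_ : stay_prob Z k * tail Z k.+1 <= _)%R.
      by rewrite mulrC ler_wpM2r.
    by rewrite lerDr sumr_ge0// => j _; rewrite !mulr_ge0.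
  rewrite -lee_fin -probE; first exact: prob_final_visit_ge.
  exact: measurable_final_visit.
- by move=> EZ2; exact: le_lt_trans (outside_expectation_le Z_pos) (a_moment EZ2).
Qed.
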